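(* Let $(P,C)$ be a Hidden Markov Model, i.e. $P\in\mathbb{R}^{n\times n}$ and $C\in\mathbb{R}^{m\times n}$ are column-stochastic, with $C\in\{0,1\}^{m\times n}$, and let $\mathcal{S}\subset\mathcal{D}(\mathbb{R}^n)$ be a finite set of probability vectors. Let $\mathcal{R_C}$ and $\mathcal{N_C}$ be the conditioned reachable and conditioned non-observable subspaces of $(P,C,\mathcal{S})$. Let $\mathcal{E_C}$ be any linear subspace with $(\mathcal{R_C}\cap\mathcal{N_C})\oplus\mathcal{E_C}=\mathcal{R_C}$ and let $p\in\mathbb{R}^n$ be any vector with $p_i>0$ for all $i$. Define $\mathscr{A}$ as follows: first put $\mathscr{A}_0=\mathrm{alg}(p^{-1}\wedge\mathcal{E_C})$; if $\mathbb{E}^T_{|\mathscr{A}_0,p}(\mathcal{R_C}\cap\mathcal{N_C})\subseteq\mathcal{R_C}\cap\mathcal{N_C}$ then $\mathscr{A}=\mathscr{A}_0$, and otherwise $\mathscr{A}=\mathrm{alg}(p^{-1}\wedge\mathcal{R_C})$. Let $d=\dim\mathscr{A}$, let $J\in\mathbb{R}^{n\times d}$ and $R\in\mathbb{R}^{d\times n}$ be the factors of $\mathbb{E}^T_{|\mathscr{A},p}=JR$ given in the context, and set $\check P=RPJ$, $\check C=CJ$. Then $d\le n$, and: (i) $\check P\in\mathbb{R}^{d\times d}$ and $\check C\in\mathbb{R}^{m\times d}$ are column-stochastic (so $(\check P,\check C)$ is a Hidden Markov Model), and $Rp_0\in\mathcal{D}(\mathbb{R}^d)$ for every $p_0\in\mathcal{S}$;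 (ii) $(\check P,\check C)$ with initial condition $Rp_0$ has the same multi-time output distribution as $(P,C)$ with initial condition $p_0$: for all $k\ge 0$, all $(y_0,\dots,y_k)\in\{1,\dots,m\}^{k+1}$ and all $p_0\in\mathcal{S}$, $$\mathbb{P}_{(P,C),p_0}[y_{0:k}]=\mathbb{P}_{(\check P,\check C),Rp_0}[y_{0:k}].$$
   Context: A matrix is column-stochastic if its entries are nonnegative and each column sums to 1. $\mathcal{D}(\mathbb{R}^k)$ denotes the set of probability vectors in $\mathbb{R}^k$ (nonnegative entries summing to 1). $\mathbf{1}$ is the all-ones vector, $\mathrm{diag}(v)$ the diagonal matrix with diagonal $v$, $e_y$ a standard basis vector. For a Hidden Markov Model $(P,C)$ with output alphabet $\{1,\dots,m\}$ put $$P_C^{y_{0:l}}=\Big(\mathrm{diag}(e_{y_l}^TC)P\Big)\cdots\Big(\mathrm{diag}(e_{y_1}^TC)P\Big)\,\mathrm{diag}(e_{y_0}^TC)$$ for a sequence $y_{0:l}=(y_0,\dots,y_l)$, $l\ge0$. The probability of observing outputs $y_{0:k}$ when the initial distribution is $p_0$ is $\mathbb{P}_{(P,C),p_0}[y_{0:k}]=\mathbf{1}^TP_C^{y_{0:k}}p_0$; the same formula with $(\check P,\check C)$ in place of $(P,C)$ defines the probabilities for the reduced model. $\mathcal{N_C}=\{v\in\mathbb{R}^n\mid \mathbf{1}^TP_C^{y_{0:l}}v=0 \text{ for all finite sequences } y_{0:l}\}$ and $\mathcal{R_C}=\mathrm{span}\{P_C^{y_{0:l}}p_0\mid y_{0:l}\text{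 any finite sequence},\ p_0\in\mathcal{S}\}$. $\wedge$ is the entrywise product on $\mathbb{R}^n$; for a vector $p$ with no zero entries, $p^{-1}$ is the entrywise inverse, and $p^{-1}\wedge\mathcal{X}=\{p^{-1}\wedge x\mid x\in\mathcal{X}\}$. A subalgebra of $\mathbb{R}^n$ is a linear subspace closed under $\wedge$ (not necessarily containing $\mathbf{1}$). $\mathrm{alg}(\mathcal{X})$ is the smallest subalgebra of $\mathbb{R}^n$ containing $\mathcal{X}$. Every subalgebra $\mathscr{A}$ of dimension $d$ has a unique (up to order) basis $a_1,\dots,a_d$ consisting of $0/1$ vectors with pairwise disjoint supports. With this basis and the standard basis $e_1,\dots,e_d$ of $\mathbb{R}^d$, and the standard inner product $\langle\cdot,\cdot\rangle$, define $$\mathbb{E}^T_{|\mathscr{A},p}=\sum_{j=1}^d\frac{(p\wedge a_j)a_j^T}{\langle p,a_j\rangle},\qquad J=\sum_{j=1}^d\frac{(p\wedge a_j)e_j^T}{\langle p,a_j\rangle},\qquad R=\sum_{j=1}^d e_ja_j^T .$$ *)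

(* Defs.v *)
From HB Require Import structures.
From mathcomp Require Import all_boot all_order all_algebra.
From mathcomp Require Import boolp classical_sets functions cardinality reals.

Set Implicit Arguments.
Unset Strict Implicit.
Unset Printing Implicit Defensive.

Import Order.TTheory GRing.Theory Num.Theory.

Local Open Scope classical_set_scope.
Local Open Scope ring_scope.

Section Subspaces.
Variables (K : fieldType) (V : vectType K).

(* The subspace with underlying set X; the default 0 is only reached when X is
   not a linear subspace (see [mem_vspace_of_set]). *)
Definition vspace_of_set (X : set V) : {vspace V} :=
  xget 0%VS [set U : {vspace V} | forall v, v \in U <-> X v].

Lemma mem_vspace_of_set (X : set V) :
    X 0 -> (forall (c : K) u v, X u -> X v -> X (c *: u + v)) ->
  forall v, v \in vspace_of_set X <-> X v.
Proof.
move=> X0 XP.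
suff /(xgetPex 0%VS): exists U : {vspace V}, forall v, v \in U <-> X v by [].
pose Q k := `[< exists U : {vspace V},
  (forall v, v \in U -> X v) /\ (k <= \dim U)%N >].
have exQ : exists k, Q k.
  exists 0%N; apply/asboolP; exists 0%VS; split=> // v.
  by rewrite memv0 => /eqP ->.
have ubQ k : Q k -> (k <= \dim {:V})%N.
  by move=> /asboolP[U [_ kU]]; apply: leq_trans kU (dimvS (subvf U)).
case: (ex_maxnP exQ ubQ) => k /asboolP[U [UX kU]] maxk.
exists U => v; split; first exact: UX.
move=> Xv; apply/negPn/negP => vU.
have /maxk : Q (\dim (<[v]> + U)%VS).
  apply/asboolP; exists (<[v]> + U)%VS; split=> // w.
  move=> /memv_addP[x /vlineP[c ->] [u uU ->]].
  by apply: XP => //; exact: UX.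
rewrite leqNgt => /negP; apply; apply: leq_ltn_trans kU _.
rewrite (ltn_leqif (dimv_leqif_sup (addvSr _ _))).
by apply: contra vU => /subvP; apply; apply: (subvP (addvSl _ _)); exact: memv_line.
Qed.

Definition span_set (X : set V) : {vspace V} :=
  vspace_of_set
    [set v | exists s : seq V, (forall x, x \in s -> X x) /\ v \in <<s>>%VS].

Lemma mem_span_set (X : set V) v :
  v \in span_set X <->
  exists s : seq V, (forall x, x \in s -> X x) /\ v \in <<s>>%VS.
Proof.
apply: (mem_vspace_of_set
  (X := [set v | exists s : seq V, (forall x, x \in s -> X x) /\ v \in <<s>>%VS])).
  by exists [::]; rewrite mem0v.
move=> c u w [s [sX us]] [t [tX wt]]; exists (s ++ t); split.
  by move=> x; rewrite mem_cat => /orP[/sX|/tX].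
by rewrite span_cat memv_add// memvZ.
Qed.

End Subspaces.

Section EntrywiseAlgebra.
Variables (R : realType) (n : nat).

Definition wedge (u v : 'cV[R]_n) : 'cV[R]_n := map2_mx *%R u v.

Definition entryinv (p : 'cV[R]_n) : 'cV[R]_n := map_mx GRing.inv p.

Definition dotprod (u v : 'cV[R]_n) : R := \sum_i u i 0 * v i 0.

Definition subalgebra (A : {vspace 'cV[R]_n}) : Prop :=
  forall u v, u \in A -> v \in A -> wedge u v \in A.

Definition alg (X : set 'cV[R]_n) : {vspace 'cV[R]_n} :=
  vspace_of_set [set v | forall A : {vspace 'cV[R]_n},
    subalgebra A -> (forall x, X x -> x \in A) -> v \in A].

Lemma mem_alg (X : set 'cV[R]_n) v :
  v \in alg X <-> forall A : {vspace 'cV[R]_n},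
    subalgebra A -> (forall x, X x -> x \in A) -> v \in A.
Proof.
apply: (mem_vspace_of_set (X := [set v | forall A : {vspace 'cV[R]_n},
    subalgebra A -> (forall x, X x -> x \in A) -> v \in A])).
  by move=> A _ _; exact: mem0v.
by move=> c u w uX wX A sA XA; apply: memvD; [apply: memvZ; exact: uX|exact: wX].
Qed.

Lemma alg_smallest (X : set 'cV[R]_n) :
  [/\ subalgebra (alg X), forall x, X x -> x \in alg X &
    forall A, subalgebra A -> (forall x, X x -> x \in A) -> (alg X <= A)%VS].
Proof.
split.
- move=> u v /mem_alg uX /mem_alg vX; apply/mem_alg => A sA XA.
  by apply: (sA); [exact: uX|exact: vX].
- by move=> x Xx; apply/mem_alg => A _; apply.
- by move=> A sA XA; apply/subvP => v /mem_alg; apply.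
Qed.

(* Bases of [A] made of 0/1 vectors with pairwise disjoint supports; such a
   basis is unique up to order when [A] is a subalgebra. *)
Definition zero_one_basis (A : {vspace 'cV[R]_n}) d (a : d.-tuple 'cV[R]_n) :
    Prop :=
  [/\ basis_of A a,
      forall j i, tnth a j i 0 = 0 \/ tnth a j i 0 = 1 &
      forall j k, j != k -> forall i, tnth a j i 0 = 0 \/ tnth a k i 0 = 0].

Lemma zero_one_basis_exists (A : {vspace 'cV[R]_n}) :
  subalgebra A -> exists a : (\dim A).-tuple 'cV[R]_n, zero_one_basis A a.
Proof.
move=> sA; pose ind (I : {set 'I_n}) : 'cV[R]_n := \col_i (i \in I)%:R.
have indI I J : wedge (ind I) (ind J) = ind (I :&: J).
  by apply/colP => i; rewrite !mxE inE mulr_natr; case: (i \in I); case: (i \in J).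
have indD I J : ind (I :\: J) = ind I - wedge (ind I) (ind J).
  apply/colP => i; rewrite !mxE inE.
  by case: (i \in I); case: (i \in J); rewrite /= ?mulr1 ?mulr0 ?subrr ?subr0.
pose good := [pred I : {set 'I_n} | (I != finset.set0) && (ind I \in A)].
pose atoms := [set I | minset good I]%SET.
have atomP I : I \in atoms -> [/\ I != finset.set0, ind I \in A &
    forall J, good J -> J \subset I -> J = I].
  by rewrite inE => /minsetP[/andP[]].
have atom_disj I J : I \in atoms -> J \in atoms -> I != J -> I :&: J = finset.set0.
  move=> /atomP[I0 IA mI] /atomP[J0 JA mJ] IJ; apply/eqP.
  apply: contraNT IJ => IJ0.
  have gIJ : good (I :&: J) by rewrite /= IJ0 -indI sA.
  by rewrite -{1}(mI _ gIJ) ?finset.subsetIl// (mJ _ gIJ) ?finset.subsetIr.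
pose s := [seq ind B | B <- enum atoms].
have ind_span k : forall I : {set 'I_n}, (#|I| <= k)%N -> ind I \in A -> ind I \in <<s>>%VS.
  elim: k => [|k IH] I Ik IA.
    suff -> : ind I = 0 by rewrite mem0v.
    by apply/colP => i; rewrite !mxE; move: Ik; rewrite leqn0 cards_eq0 => /eqP ->; rewrite inE.
  have [->|I0] := eqVneq I finset.set0.
    suff -> : ind finset.set0 = 0 by rewrite mem0v.
    by apply/colP => i; rewrite !mxE inE.
  have gI : good I by rewrite /= I0.
  have [J mJ JI] := minset_exists gI.
  have Jat : J \in atoms by rewrite inE.
  have [J0 JA _] := atomP _ Jat.
  have -> : ind I = ind (I :\: J) + ind J.
    apply/colP => i; rewrite !mxE inE.
    by have := fintype.subsetP JI i; case: (i \in I); case: (i \in J) => //= H;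
      rewrite ?addr0 ?add0r//; have := H isT.
  apply: memvD; last by apply: memv_span; apply/map_f; rewrite mem_enum.
  apply: IH.
    rewrite -ltnS; apply: leq_trans Ik; apply: proper_card.
    rewrite properE finset.subsetDl /=.
    have /finset.set0Pn[j jJ] := J0.
    by apply/negP => /fintype.subsetP/(_ j (fintype.subsetP JI _ jJ)); rewrite inE jJ.
  by rewrite indD memvB// sA.
have polyA (v : 'cV[R]_n) (q : {poly R}) : v \in A -> map_mx (fun x => x * q.[x]) v \in A.
  move=> vA; elim/poly_ind: q => [|q c IH].
    suff -> : map_mx (fun x => x * (0 : {poly R}).[x]) v = 0 by rewrite mem0v.
    by apply/colP => i; rewrite !mxE horner0 mulr0.
  have -> : map_mx (fun x => x * (q * 'X + c%:P).[x]) v =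
      wedge (map_mx (fun x => x * q.[x]) v) v + c *: v.
    by apply/colP => i; rewrite !mxE !hornerE mulrDr mulrA [c * _]mulrC.
  by rewrite memvD ?memvZ ?sA.
have levelA (v : 'cV[R]_n) c : v \in A -> c != 0 -> ind [set i | v i 0 == c]%SET \in A.
  move=> vA c0.
  pose q := \prod_(x <- [seq v i 0 | i <- enum 'I_n & v i 0 != c]) ('X - x%:P).
  have qc : c * q.[c] != 0.
    rewrite mulf_neq0// -rootE root_prod_XsubC; apply/mapP => -[i].
    by rewrite mem_filter => /andP[vi _] cv; rewrite cv eqxx in vi.
  suff -> : ind [set i | v i 0 == c]%SET =
      (c * q.[c])^-1 *: map_mx (fun x => x * q.[x]) v by rewrite memvZ ?polyA.
  apply/colP => i; rewrite !mxE inE; have [->|vic] := eqVneq; first by rewrite mulVf.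
  suff -> : q.[v i 0] = 0 by rewrite !mulr0.
  apply/eqP; rewrite -rootE root_prod_XsubC; apply/mapP.
  by exists i => //; rewrite mem_filter vic mem_enum.
have spanA : <<s>>%VS = A.
  apply/eqP; rewrite eqEsubv; apply/andP; split.
    apply/span_subvP => _ /mapP[I + ->]; rewrite mem_enum => /atomP[]//.
  apply/subvP => v vA.
  have -> : v = \sum_(c <- undup [seq v i 0 | i in 'I_n]) c *: ind [set i | v i 0 == c]%SET.
    apply/colP => i; rewrite summxE.
    rewrite (bigD1_seq (v i 0)) ?undup_uniq //=; last first.
      by rewrite mem_undup; apply: map_f; rewrite mem_enum.
    rewrite !mxE inE eqxx mulr1 big1 ?addr0// => c cv.
    by rewrite !mxE inE eq_sym (negbTE cv) mulr0.
  apply: (big_rec (fun w => w \in <<s>>%VS)) => [|c w _ ws]; first exact: mem0v.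
  have [->|c0] := eqVneq c 0; first by rewrite scale0r add0r.
  by rewrite memvD// memvZ// (ind_span n) ?levelA// (leq_trans (max_card _)) ?card_ord.
have nth_s (j : 'I_(size s)) : exists2 I, I \in atoms & nth 0 s j = ind I /\ I = nth finset.set0 (enum atoms) j.
  have jlt : (j < size (enum atoms))%N by rewrite -(size_map ind) ltn_ord.
  exists (nth finset.set0 (enum atoms) j); first by rewrite -mem_enum mem_nth.
  by rewrite (nth_map finset.set0).
have disj (j k : 'I_(size s)) i : j != k -> nth 0 s j i 0 = 0 \/ nth 0 s k i 0 = 0.
  move=> jk; have [I Ia [-> Ij]] := nth_s j; have [J Ja [-> Jk]] := nth_s k.
  have IJ : I != J.
    rewrite Ij Jk nth_uniq ?enum_uniq -?(size_map ind) ?ltn_ord//.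
  rewrite !mxE; have := atom_disj _ _ Ia Ja IJ => /finset.setP/(_ i); rewrite !inE.
  by case: (i \in I) => /= [->|]; [right|left].
have freeS : free s.
  apply/(@freeP _ _ _ (in_tuple s)) => k /= k0 j.
  have [I /atomP[/finset.set0Pn[i iI] _ _] [sj _]] := nth_s j.
  have := congr1 (fun M : 'cV[R]_n => M i 0) k0; rewrite summxE (bigD1 j)//= big1 ?addr0.
    by rewrite sj !mxE iI mulr1.
  move=> l lj; rewrite mxE; have [->|] := disj l j i lj; first by rewrite mulr0.
  by rewrite sj mxE iI => /eqP; rewrite oner_eq0.
have bs : basis_of A s by rewrite /basis_of spanA eqxx freeS.
have ds : size s = \dim A by rewrite (@size_basis _ _ _ _ (in_tuple s) bs).
have /eqP ds' := ds; exists (Tuple ds'); split=> //=.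
- move=> j i; rewrite (tnth_nth 0) /=.
  have jlt : (j < size s)%N by rewrite ds.
  have [I _ [-> _]] := nth_s (Ordinal jlt); rewrite mxE.
  by case: (i \in I); [right|left].
- move=> j k jk i; rewrite !(tnth_nth 0) /=.
  have jlt : (j < size s)%N by rewrite ds.
  have klt : (k < size s)%N by rewrite ds.
  exact: (disj (Ordinal jlt) (Ordinal klt)).
Qed.

(* For a [zero_one_basis] [a] of an algebra, [condexp a p] is the matrix of the
   transposed conditional expectation onto that algebra; it does not depend on
   the order of [a]. *)
Definition condexp d (a : d.-tuple 'cV[R]_n) (p : 'cV[R]_n) : 'M[R]_n :=
  \sum_(j < d) (dotprod p (tnth a j))^-1 *:
    (wedge p (tnth a j) *m (tnth a j)^T).

Definition injection d (a : d.-tuple 'cV[R]_n) (p : 'cV[R]_n) : 'M[R]_(n, d) :=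
  \sum_(j < d) (dotprod p (tnth a j))^-1 *:
    (wedge p (tnth a j) *m (delta_mx j 0 : 'cV[R]_d)^T).

Definition restriction d (a : d.-tuple 'cV[R]_n) : 'M[R]_(d, n) :=
  \sum_(j < d) (delta_mx j 0 : 'cV[R]_d) *m (tnth a j)^T.

Lemma condexp_factor d (a : d.-tuple 'cV[R]_n) p :
  condexp a p = injection a p *m restriction a.
Proof.
rewrite mulmx_suml; apply: eq_bigr => j _.
rewrite mulmx_sumr (bigD1 j)//= big1 ?addr0.
  rewrite -scalemxAl !mulmxA -(mulmxA _ _^T (delta_mx _ _)) trmx_delta.
  by rewrite mul_delta_mx [delta_mx 0 0]mx11_scalar mxE !eqxx mulmx1.
move=> k kj; rewrite -scalemxAl !mulmxA -(mulmxA _ _^T (delta_mx _ _)).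
by rewrite trmx_delta mul_delta_mx_0 1?eq_sym// mulmx0 mul0mx scaler0.
Qed.

End EntrywiseAlgebra.

Section HiddenMarkovModels.
Variable R : realType.

Definition column_stochastic r c (A : 'M[R]_(r, c)) : Prop :=
  (forall i j, 0 <= A i j) /\ (forall j, \sum_i A i j = 1).

Definition prob_vector k (v : 'cV[R]_k) : Prop :=
  (forall i, 0 <= v i 0) /\ \sum_i v i 0 = 1.

Definition hmm n m (P : 'M[R]_n) (C : 'M[R]_(m, n)) : Prop :=
  column_stochastic P /\ column_stochastic C.

(* Output sequences y_0, ..., y_l are (l+1)-tuples; the factor of the latest
   output is leftmost in the product. *)
Definition cond_prod n m (P : 'M[R]_n) (C : 'M[R]_(m, n)) l
    (y : l.+1.-tuple 'I_m) : 'M[R]_n :=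
  foldl (fun M z => diag_mx (row z C) *m P *m M)
    (diag_mx (row (thead y) C)) (behead y).

Definition out_prob n m (P : 'M[R]_n) (C : 'M[R]_(m, n)) (p0 : 'cV[R]_n) l
    (y : l.+1.-tuple 'I_m) : R :=
  ((const_mx 1 : 'rV[R]_n) *m cond_prod P C y *m p0) 0 0.

Definition cond_nonobs n m (P : 'M[R]_n) (C : 'M[R]_(m, n)) :
    {vspace 'cV[R]_n} :=
  vspace_of_set [set v | forall l (y : l.+1.-tuple 'I_m),
    (const_mx 1 : 'rV[R]_n) *m cond_prod P C y *m v = 0].

Lemma mem_cond_nonobs n m (P : 'M[R]_n) (C : 'M[R]_(m, n)) v :
  v \in cond_nonobs P C <-> forall l (y : l.+1.-tuple 'I_m),
    (const_mx 1 : 'rV[R]_n) *m cond_prod P C y *m v = 0.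
Proof.
apply: (mem_vspace_of_set (X := [set v | forall l (y : l.+1.-tuple 'I_m),
    (const_mx 1 : 'rV[R]_n) *m cond_prod P C y *m v = 0])).
  by move=> l y; rewrite mulmx0.
by move=> c u w uN wN l y; rewrite mulmxDr -scalemxAr uN wN scaler0 addr0.
Qed.

Definition cond_reach n m (P : 'M[R]_n) (C : 'M[R]_(m, n))
    (S : set 'cV[R]_n) : {vspace 'cV[R]_n} :=
  span_set [set v | exists l (y : l.+1.-tuple 'I_m) p0,
    S p0 /\ v = cond_prod P C y *m p0].

Definition distorted_alg n (p : 'cV[R]_n) (X : {vspace 'cV[R]_n}) :
    {vspace 'cV[R]_n} :=
  alg [set wedge (entryinv p) x | x in [set` X]].

(* [a0] is meant to be a [zero_one_basis] of [distorted_alg p E]. *)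
Definition reduction_alg n m (P : 'M[R]_n) (C : 'M[R]_(m, n))
    (S : set 'cV[R]_n) (E : {vspace 'cV[R]_n}) (p : 'cV[R]_n) d0
    (a0 : d0.-tuple 'cV[R]_n) : {vspace 'cV[R]_n} :=
  let RN := (cond_reach P C S :&: cond_nonobs P C)%VS in
  if `[< forall v, v \in RN -> condexp a0 p *m v \in RN >]
  then distorted_alg p E
  else distorted_alg p (cond_reach P C S).

End HiddenMarkovModels.

(* Main.v *)
Require Import Defs.
From HB Require Import structures.
From mathcomp Require Import all_boot all_order all_algebra.
From mathcomp Require Import boolp classical_sets functions cardinality reals.
From mathcomp Require Import ring.

(* Let [R] be the reachable and [N] the non-observable subspace. Both are stable
   under the transition matrix and under the output masks [diag (e_y^T C)]; for
   the masks this uses that [C] is 0/1, so that they are orthogonal projections.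
   The expectation [condexp a p] is the projection onto [p /\ A] along the
   orthogonal of [A], so it fixes [E] (resp. [R]), and in both cases of the
   construction it maps each [x] in [R] to [x] modulo [R \cap N]. Inserting it
   between the steps of the dynamics, which is what the reduced model does,
   hence changes the state only inside [R \cap N], which the outputs do not see.

   The algebra need not contain the all-ones vector, so stochasticity of the
   reduced transition matrix is not automatic: it holds because [R] is spanned
   by nonnegative vectors on which the expectation preserves total mass. *)

Set Implicit Arguments.
Unset Strict Implicit.
Unset Printing Implicit Defensive.

Import Order.TTheory GRing.Theory Num.Theory.

Local Open Scope classical_set_scope.
Local Open Scope ring_scope.

(** * Inner product and entrywise inverse *)

Section DotProduct.
Variables (R : realType) (n : nat).
Implicit Types u v w p : 'cV[R]_n.

Lemma dotprodC u v : dotprod u v = dotprod v u.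
Proof. by apply: eq_bigr => i _; rewrite mulrC. Qed.

Lemma dotprodE u v : dotprod u v = (u^T *m v) 0 0.
Proof. by rewrite mxE; apply: eq_bigr => i _; rewrite mxE. Qed.

Lemma dotprodBr u v w : dotprod u (v - w) = dotprod u v - dotprod u w.
Proof. by rewrite -sumrB; apply: eq_bigr => i _; rewrite !mxE mulrBr. Qed.

Lemma wedge_entryinvK p v : (forall i, 0 < p i 0) ->
  wedge p (wedge (entryinv p) v) = v.
Proof.
by move=> hp; apply/colP => i; rewrite !mxE mulVKf ?gt_eqF.
Qed.

End DotProduct.

(** * Zero-one bases and the expectation they define *)

Section ZeroOneBasis.
Variables (R : realType) (n d : nat) (A : {vspace 'cV[R]_n}).
Variables (a : d.-tuple 'cV[R]_n) (ha : zero_one_basis A a).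
Variables (p : 'cV[R]_n) (hp : forall i, 0 < p i 0).

Lemma zero_one_basis_ge0 j i : 0 <= tnth a j i 0.
Proof. by have [_ /(_ j i)[]-> _] := ha. Qed.

Lemma zero_one_basis_mem j : tnth a j \in A.
Proof. by have [/basis_mem + _ _] := ha; apply; rewrite mem_tnth. Qed.

Lemma zero_one_basis_mul j k i :
  tnth a j i 0 * tnth a k i 0 = (j == k)%:R * tnth a k i 0.
Proof.
have [_ h01 hdis] := ha; have [<-|jk] := eqVneq.
  by rewrite mul1r; have [->|->] := h01 j i; rewrite ?mulr0 ?mulr1.
by rewrite mul0r; have [->|->] := hdis _ _ jk i; rewrite ?mul0r ?mulr0.
Qed.

(** Disjoint supports leave at most one nonzero term. The sum is 0 at an index outside all supports,
    which can occur when the all-ones vector is not in [A]. *)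
Lemma sum_zero_one_basis_le1 i : \sum_j tnth a j i 0 <= 1.
Proof.
have [->|] := eqVneq (\sum_j tnth a j i 0) 0; first exact: ler01.
rewrite psumr_neq0 => [/hasP[j _ /= aj_gt0]|j _]; last exact: zero_one_basis_ge0.
rewrite (bigD1 j)//= big1 ?addr0 => [|k kj].
  by have [_ /(_ j i)[]-> _] := ha.
apply/eqP; have /eqP := zero_one_basis_mul k j i.
by rewrite (negbTE kj) mul0r mulf_eq0 (gt_eqF aj_gt0) orbF.
Qed.

Lemma zero_one_basis_neq0 j : tnth a j != 0.
Proof.
have [/basis_free + _ _] := ha => /free_not0 h.
by apply: h; rewrite mem_tnth.
Qed.

Lemma zero_one_basis_dotprod_gt0 j : 0 < dotprod p (tnth a j).
Proof.
have t_ge0 i : 0 <= p i 0 * tnth a j i 0.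
  by rewrite mulr_ge0 ?zero_one_basis_ge0// ltW.
rewrite lt_def sumr_ge0// andbT; apply/eqP => /eqP.
rewrite psumr_eq0// => /allP h.
have /eqP := zero_one_basis_neq0 j; apply; apply/colP => i; rewrite mxE.
have /h : i \in index_enum 'I_n by rewrite mem_index_enum.
by rewrite mulf_eq0 gt_eqF//= => /eqP.
Qed.

Lemma restrictionE j i : restriction a j i = tnth a j i 0.
Proof.
rewrite summxE (bigD1 j)//= big1 ?addr0 => [|k kj].
  by rewrite mxE big_ord1 !mxE !eqxx mul1r.
by rewrite mxE big_ord1 !mxE eq_sym (negbTE kj) mul0r.
Qed.

Lemma injectionE i j :
  injection a p i j = (dotprod p (tnth a j))^-1 * (p i 0 * tnth a j i 0).
Proof.
rewrite summxE (bigD1 j)//= big1 ?addr0 => [|k kj].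
  by rewrite mxE mxE big_ord1 !mxE !eqxx mulr1.
by rewrite mxE mxE big_ord1 !mxE [j == k]eq_sym (negbTE kj) !mulr0.
Qed.

Lemma restriction_ge0 j i : 0 <= restriction a j i.
Proof. by rewrite restrictionE zero_one_basis_ge0. Qed.

Lemma injection_ge0 i j : 0 <= injection a p i j.
Proof.
rewrite injectionE mulr_ge0 ?invr_ge0 ?(ltW (zero_one_basis_dotprod_gt0 j))//.
by rewrite mulr_ge0 ?zero_one_basis_ge0// ltW.
Qed.

Lemma ones_injection :
  (const_mx 1 : 'rV[R]_n) *m injection a p = const_mx 1.
Proof.
apply/rowP => j; rewrite !mxE.
under eq_bigr do rewrite mxE mul1r injectionE.
by rewrite -mulr_sumr mulVf// gt_eqF// zero_one_basis_dotprod_gt0.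
Qed.

Lemma condexp_mulE x : condexp a p *m x =
  \sum_j (dotprod (tnth a j) x / dotprod p (tnth a j)) *: wedge p (tnth a j).
Proof.
rewrite mulmx_suml; apply: eq_bigr => j _.
rewrite -scalemxAl -mulmxA [_^T *m x]mx11_scalar mul_mx_scalar scalerA.
by rewrite -dotprodE mulrC.
Qed.

Lemma condexp_range x : exists2 v, v \in A & condexp a p *m x = wedge p v.
Proof.
exists (\sum_j (dotprod (tnth a j) x / dotprod p (tnth a j)) *: tnth a j).
  by rewrite memv_suml// => j _; rewrite memvZ// zero_one_basis_mem.
rewrite condexp_mulE; apply/colP => i; rewrite mxE !summxE mulr_sumr.
by apply: eq_bigr => j _; rewrite !mxE mulrCA.
Qed.

(** Together with [condexp_range] this determines the expectation independently of the basis, as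
    [condexp_uniq] shows. For a basis vector [b], only the term of the same index survives. *)
Lemma condexp_dotprod b x : b \in A ->
  dotprod b (condexp a p *m x) = dotprod b x.
Proof.
have basis_case k : dotprod (tnth a k) (condexp a p *m x) = dotprod (tnth a k) x.
  rewrite condexp_mulE dotprodE mulmx_sumr summxE (bigD1 k)//= big1 ?addr0.
    rewrite -scalemxAr mxE -dotprodE.
    suff -> : dotprod (tnth a k) (wedge p (tnth a k)) = dotprod p (tnth a k).
      by rewrite divfK// gt_eqF// zero_one_basis_dotprod_gt0.
    apply: eq_bigr => i _.
    by rewrite mxE mulrCA zero_one_basis_mul eqxx mul1r.
  move=> j jk; rewrite -scalemxAr mxE -dotprodE.
  rewrite [X in _ * X]big1 ?mulr0// => i _.
  by rewrite mxE mulrCA zero_one_basis_mul eq_sym (negbTE jk) mul0r mulr0.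
have [bA _ _] := ha => /(coord_basis bA) ->.
rewrite ![dotprod (\sum_k _) _]dotprodC !dotprodE !mulmx_sumr !summxE.
apply: eq_bigr => k _; rewrite -!scalemxAr [LHS]mxE [RHS]mxE -!dotprodE.
by rewrite -tnth_nth dotprodC basis_case dotprodC.
Qed.

(** Testing against [v] itself gives a sum of squares with the positive weights [p]. *)
Lemma wedge_orthogonal_eq0 v :
  (forall b, b \in A -> dotprod b (wedge p v) = 0) -> v \in A -> v = 0.
Proof.
move=> h /h; rewrite /dotprod => /eqP; rewrite psumr_eq0 => [/allP h0|i _].
  apply/colP => i; rewrite mxE.
  have /h0 : i \in index_enum 'I_n by rewrite mem_index_enum.
  by rewrite mxE !mulf_eq0 (gt_eqF (hp i)) orbb => /eqP.
by rewrite mxE mulrCA -expr2 mulr_ge0 ?sqr_ge0// ltW.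
Qed.

Lemma condexp_uniq x v : v \in A ->
  (forall b, b \in A -> dotprod b (wedge p v) = dotprod b x) ->
  condexp a p *m x = wedge p v.
Proof.
move=> vA hv; have [w wA Ew] := condexp_range x; rewrite Ew.
suff /eqP : w - v = 0 by rewrite subr_eq0 => /eqP ->.
have wB : wedge p (w - v) = wedge p w - wedge p v.
  by apply/colP => i; rewrite !mxE mulrBr.
apply: wedge_orthogonal_eq0; last by rewrite memvB.
by move=> b bA; rewrite wB dotprodBr hv// -Ew condexp_dotprod// subrr.
Qed.

Lemma condexp_id v : v \in A -> condexp a p *m wedge p v = wedge p v.
Proof. by move=> vA; apply: condexp_uniq. Qed.

(** [injection] preserves total mass, so mass in the reduced space can be measured after lifting. *)
Lemma ones_restriction (x : 'cV[R]_n) :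
  (const_mx 1 : 'rV[R]_d) *m (restriction a *m x) =
  (const_mx 1 : 'rV[R]_n) *m (condexp a p *m x).
Proof. by rewrite condexp_factor -mulmxA !mulmxA ones_injection. Qed.

(** For [u] a row of [C], the output mask of the reduced model is the compression of the original
    mask. *)
Lemma restriction_diag_injection (u : 'rV[R]_n) :
  restriction a *m diag_mx u *m injection a p = diag_mx (u *m injection a p).
Proof.
apply/matrixP => j k; rewrite mul_mx_diag !mxE -sumrMnl; apply: eq_bigr => i _.
rewrite mxE restrictionE !injectionE -mulr_natr.
have := zero_one_basis_mul j k i; have [<-|_] := eqVneq j k => E.
  rewrite mul1r in E; rewrite mulr1 -[in RHS]E; ring.
rewrite mul0r in E; rewrite mulr0.
rewrite -[RHS](mulr0 (u 0 i * (dotprod p (tnth a k))^-1 * p i 0)) -E; ring.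
Qed.

End ZeroOneBasis.

(** The stability test is stated with the basis [a0], the reduced model with [a]; this links the
    two. *)
Lemma condexp_basis_irrelevant (R : realType) n (A : {vspace 'cV[R]_n}) d e
    (a : d.-tuple 'cV[R]_n) (b : e.-tuple 'cV[R]_n) (p : 'cV[R]_n) :
  zero_one_basis A a -> zero_one_basis A b -> (forall i, 0 < p i 0) ->
  forall x : 'cV[R]_n, condexp a p *m x = condexp b p *m x.
Proof.
move=> ha hb hp x; have [v vA vE] := condexp_range hb p x.
rewrite vE; apply: (condexp_uniq ha hp vA) => c cA.
by rewrite -vE (condexp_dotprod hb hp).
Qed.

Lemma condexp_distorted_id (R : realType) n (p : 'cV[R]_n)
    (X : {vspace 'cV[R]_n}) d (a : d.-tuple 'cV[R]_n) :
  (forall i, 0 < p i 0) -> zero_one_basis (distorted_alg p X) a ->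
  forall x, x \in X -> condexp a p *m x = x.
Proof.
move=> hp ha x xX; rewrite -[in LHS](wedge_entryinvK x hp) (condexp_id ha hp).
  exact: wedge_entryinvK.
by have [_ + _] := alg_smallest [set wedge (entryinv p) x | x in [set` X]];
  apply; exists x.
Qed.

(** * Invariance of the reachable and non-observable subspaces *)

Section HiddenMarkovModels.
Variables (R : realType) (n m : nat) (P : 'M[R]_n) (C : 'M[R]_(m, n)).
Variable S : set 'cV[R]_n.
Hypothesis hPC : hmm P C.
Hypothesis hC01 : forall y i, C y i = 0 \/ C y i = 1.

Local Notation D y := (diag_mx (row y C)).
Local Notation ones := (const_mx 1 : 'rV[R]_n).
Local Notation reach := (cond_reach P C S).
Local Notation nonobs := (cond_nonobs P C).

Lemma sum_output : \sum_y D y = 1%:M.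
Proof.
rewrite -raddf_sum /= -diag_const_mx; congr diag_mx; apply/rowP => i.
by rewrite summxE mxE -(hPC.2.2 i); apply: eq_bigr => y _; rewrite mxE.
Qed.

Lemma sum_output_mul (x : 'cV[R]_n) : x = \sum_y D y *m x.
Proof. by rewrite -mulmx_suml sum_output mul1mx. Qed.

Lemma output_mul y z : D y *m D z = (y == z)%:R *: D z.
Proof.
rewrite mulmx_diag -linearZ /=; congr diag_mx; apply/rowP => i; rewrite !mxE.
have [<-|yz] := eqVneq.
  by have [->|->] := hC01 y i; rewrite ?mulr0 ?mulr1.
have [->|Cy] := hC01 y i; first by rewrite !mul0r.
have [->|Cz] := hC01 z i; first by rewrite !mulr0.
(* Two ones in the same column would push its sum above 1. *)
have := hPC.2.2 i; rewrite (bigD1 y)//= (bigD1 z) 1?eq_sym//= Cy Cz.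
move=> /eqP; rewrite -subr_eq0 addrAC subrr add0r gt_eqF//.
by rewrite ltr_pwDl// sumr_ge0// => k _; exact: hPC.2.1.
Qed.

(** A form of [cond_prod] over plain lists, which allows induction at either end. The free dimension
    [k] lets it cover the reduced model too. *)
Definition cond_seq k (T : 'M[R]_k) (O : 'M[R]_(m, k)) y0 (s : seq 'I_m) :=
  foldl (fun M z => diag_mx (row z O) *m T *m M) (diag_mx (row y0 O)) s.

Lemma cond_prod_seq k (T : 'M[R]_k) (O : 'M[R]_(m, k)) l
    (y : l.+1.-tuple 'I_m) :
  cond_prod T O y = cond_seq T O (thead y) (behead y).
Proof. by []. Qed.

Lemma cond_seq_prod k (T : 'M[R]_k) (O : 'M[R]_(m, k)) y0 s :
  cond_seq T O y0 s = cond_prod T O [tuple of y0 :: in_tuple s].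
Proof. by rewrite /cond_prod theadE. Qed.

Lemma cond_seq_rcons k (T : 'M[R]_k) (O : 'M[R]_(m, k)) y0 s z :
  cond_seq T O y0 (rcons s z) = diag_mx (row z O) *m T *m cond_seq T O y0 s.
Proof. by rewrite /cond_seq foldl_rcons. Qed.

(** Here the earliest output is split off, on the side where the state enters; the recursion by
    [rcons] splits off the latest. *)
Lemma cond_seq_cons y0 y1 s :
  cond_seq P C y0 (y1 :: s) = cond_seq P C y1 s *m P *m D y0.
Proof.
elim/last_ind: s => [//|s z IH].
by rewrite -rcons_cons !cond_seq_rcons IH !mulmxA.
Qed.

(** The leftmost factor is already a mask, and masks are orthogonal idempotents, so the scalar is 0
    or 1. *)
Lemma output_cond_seq z y0 s :
  exists c, D z *m cond_seq P C y0 s = c *: cond_seq P C y0 s.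
Proof.
elim/last_ind: s => [|s w _]; first by eexists; exact: output_mul.
by eexists; rewrite cond_seq_rcons !mulmxA output_mul -!scalemxAl.
Qed.

Lemma cond_seq_output z y0 s :
  exists c, cond_seq P C y0 s *m D z = c *: cond_seq P C y0 s.
Proof.
have DD : D y0 *m D z = (z == y0)%:R *: D y0 by rewrite diag_mxC output_mul.
case: s => [|y1 s]; first by exists (z == y0)%:R.
by exists (z == y0)%:R; rewrite cond_seq_cons -mulmxA DD -scalemxAr.
Qed.

Lemma mem_cond_reach y0 s p0 : S p0 -> cond_seq P C y0 s *m p0 \in reach.
Proof.
move=> Sp0; apply/mem_span_set; exists [:: cond_seq P C y0 s *m p0].
split=> [x|]; last by rewrite memv_span// mem_head.
rewrite inE => /eqP ->; exists (size s), [tuple of y0 :: in_tuple s], p0.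
by rewrite cond_seq_prod.
Qed.

Lemma cond_reach_ind (U : {vspace 'cV[R]_n}) :
  (forall y0 s p0, S p0 -> cond_seq P C y0 s *m p0 \in U) -> (reach <= U)%VS.
Proof.
move=> genU; apply/subvP => x /mem_span_set[t [tS xt]].
apply: subvP xt; apply/span_subvP => _ /tS[l [y [p0 [Sp0 ->]]]].
by rewrite cond_prod_seq genU.
Qed.

Lemma cond_reach_stable (M : 'M[R]_n) :
    (forall y0 s p0, S p0 -> M *m (cond_seq P C y0 s *m p0) \in reach) ->
  forall x, x \in reach -> M *m x \in reach.
Proof.
move=> genM x xR.
suff /subvP/(_ x xR) : (reach <= linfun (mulmx M) @^-1: reach)%VS.
  by rewrite -memv_preim lfunE.
by apply: cond_reach_ind => y0 s p0 Sp0; rewrite -memv_preim lfunE genM.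
Qed.

Lemma output_reach y x : x \in reach -> D y *m x \in reach.
Proof.
apply: cond_reach_stable => {x} y0 s p0 Sp0; rewrite mulmxA.
have [c ->] := output_cond_seq y y0 s.
by rewrite -scalemxAl memvZ// mem_cond_reach.
Qed.

(** The masks sum to the identity, so a transition after a run is a sum of runs prolonged by one
    output. *)
Lemma transition_reach x : x \in reach -> P *m x \in reach.
Proof.
apply: cond_reach_stable => {x} y0 s p0 Sp0; rewrite [_ *m _]sum_output_mul.
rewrite memv_suml// => y _.
by rewrite !mulmxA -cond_seq_rcons mem_cond_reach.
Qed.

(** Every run begins with a mask, so [p0] is recovered as the sum of its one-output runs. *)
Lemma init_reach p0 : S p0 -> p0 \in reach.
Proof.
move=> Sp0; rewrite [p0]sum_output_mul memv_suml// => y _.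
exact: (mem_cond_reach y [::]).
Qed.

Lemma mem_nonobs_seq x :
  x \in nonobs <-> forall y0 s, ones *m cond_seq P C y0 s *m x = 0.
Proof.
rewrite mem_cond_nonobs; split=> [h y0 s|h l y].
  by rewrite cond_seq_prod h.
by rewrite cond_prod_seq h.
Qed.

Lemma output_nonobs y x : x \in nonobs -> D y *m x \in nonobs.
Proof.
move=> /mem_nonobs_seq xN; apply/mem_nonobs_seq => y0 s.
have [c cE] := cond_seq_output y y0 s.
by rewrite mulmxA -(mulmxA ones) cE -scalemxAr -scalemxAl xN scaler0.
Qed.

(** Decomposing [x] by the masks turns each term into a run with one more output in front. *)
Lemma transition_nonobs x : x \in nonobs -> P *m x \in nonobs.
Proof.
move=> /mem_nonobs_seq xN; apply/mem_nonobs_seq => y0 s.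
rewrite [x]sum_output_mul !mulmx_sumr big1// => y _.
by rewrite !mulmxA -2!(mulmxA ones) -cond_seq_cons xN.
Qed.

Lemma ones_nonobs x : x \in nonobs -> ones *m x = 0.
Proof.
move=> /mem_nonobs_seq xN; rewrite [x]sum_output_mul mulmx_sumr big1// => y _.
by rewrite mulmxA (xN y [::]).
Qed.

Lemma ones_transition : ones *m P = ones.
Proof.
apply/rowP => j; rewrite !mxE -[RHS](hPC.1.2 j).
by apply: eq_bigr => i _; rewrite mxE mul1r.
Qed.

Lemma cond_seq_ge0 y0 s i j : 0 <= cond_seq P C y0 s i j.
Proof.
have D_ge0 y k l : 0 <= D y k l by rewrite !mxE mulrn_wge0// hPC.2.1.
elim/last_ind: s i j => [|s z IH] i j; first exact: D_ge0.
rewrite cond_seq_rcons -mulmxA mxE.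
apply: sumr_ge0 => k _; rewrite mulr_ge0// mxE sumr_ge0// => l _.
by rewrite mulr_ge0// hPC.1.1.
Qed.

End HiddenMarkovModels.

(** * The reduced model, for an expectation that moves reachable vectors only inside [unobs] *)

Section Reduction.
Variables (R : realType) (n m : nat) (P : 'M[R]_n) (C : 'M[R]_(m, n)).
Variable S : set 'cV[R]_n.
Hypothesis hPC : hmm P C.
Hypothesis hC01 : forall y i, C y i = 0 \/ C y i = 1.
Hypothesis hSprob : forall p0, S p0 -> prob_vector p0.
Variables (d : nat) (A : {vspace 'cV[R]_n}) (a : d.-tuple 'cV[R]_n).
Hypothesis ha : zero_one_basis A a.
Variables (p : 'cV[R]_n) (hp : forall i, 0 < p i 0).

Local Notation reach := (cond_reach P C S).
Local Notation unobs := (cond_reach P C S :&: cond_nonobs P C)%VS.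
Local Notation J := (injection a p).
Local Notation Q := (restriction a).

Hypothesis condexp_unobs : forall x, x \in reach -> condexp a p *m x - x \in unobs.

Lemma ones_restriction_reach x : x \in reach ->
  (const_mx 1 : 'rV[R]_d) *m (Q *m x) = (const_mx 1 : 'rV[R]_n) *m x.
Proof.
move=> /condexp_unobs; rewrite memv_cap => /andP[_ /(ones_nonobs hPC)] /eqP.
by rewrite mulmxBr subr_eq0 (ones_restriction ha hp) => /eqP.
Qed.

(** Induction invariant: the reduced state is the restriction of a reachable [z] that agrees with
    the true state modulo [unobs]. *)
Lemma reduced_cond_seq x y0 s : x \in reach ->
  exists z, [/\ cond_seq (Q *m P *m J) (C *m J) y0 s *m (Q *m x) = Q *m z,
    z \in reach & z - cond_seq P C y0 s *m x \in unobs].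
Proof.
move=> xR; have rowCJ y : row y (C *m J) = row y C *m J by rewrite row_mul.
have QJ : J *m Q = condexp a p by rewrite condexp_factor.
have unobsP M z : (forall v, v \in reach -> M *m v \in reach) ->
    (forall v, v \in cond_nonobs P C -> M *m v \in cond_nonobs P C) ->
    z \in unobs -> M *m z \in unobs.
  by move=> MR MN; rewrite !memv_cap => /andP[/MR -> /MN ->].
have DU y z : z \in unobs -> diag_mx (row y C) *m z \in unobs.
  by apply: unobsP => v; [exact: output_reach|exact: output_nonobs].
have PU z : z \in unobs -> P *m z \in unobs.
  by apply: unobsP => v; [exact: transition_reach|exact: transition_nonobs].
have ER z : z \in reach -> condexp a p *m z \in reach.
  move=> zR; rewrite -(subrK z (_ *m z)) memvD//.
  by apply: subvP (capvSl _ _) _ _; exact: condexp_unobs.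
elim/last_ind: s => [|s y [z [zE zR zU]]].
  exists (diag_mx (row y0 C) *m (condexp a p *m x)); split.
  - by rewrite /cond_seq /= rowCJ -(restriction_diag_injection ha p) -QJ !mulmxA.
  - by apply: output_reach => //; exact: ER.
  - by rewrite -mulmxBr; apply: DU; exact: condexp_unobs.
pose w := P *m (condexp a p *m z).
have wR : w \in reach by apply: transition_reach => //; exact: ER.
exists (diag_mx (row y C) *m (condexp a p *m w)); split.
- rewrite cond_seq_rcons -mulmxA zE rowCJ -(restriction_diag_injection ha p).
  by rewrite /w -QJ !mulmxA.
- by apply: output_reach => //; exact: ER.
rewrite cond_seq_rcons -!mulmxA -mulmxBr; apply: DU.
(* The error is telescoped through [w], then through [z]: two expectations are inserted per step,
   and each adds an error in [unobs]. *)
rewrite -(subrK w (condexp a p *m w)) -addrA memvD ?condexp_unobs//.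
rewrite /w -mulmxBr; apply: PU.
by rewrite -(subrK z (condexp a p *m z)) -addrA memvD ?condexp_unobs.
Qed.

Lemma reduced_out_prob k (y : k.+1.-tuple 'I_m) p0 : S p0 ->
  out_prob P C p0 y = out_prob (Q *m P *m J) (C *m J) (Q *m p0) y.
Proof.
move=> /(init_reach hPC) p0R; rewrite /out_prob !cond_prod_seq.
rewrite -[in LHS]mulmxA -[in RHS]mulmxA.
have [z [zE zR]] := reduced_cond_seq (thead y) (behead y) p0R.
rewrite memv_cap => /andP[_ /(ones_nonobs hPC)] /eqP.
by rewrite mulmxBr subr_eq0 zE ones_restriction_reach// => /eqP ->.
Qed.

Lemma reduced_init p0 : S p0 -> prob_vector (Q *m p0).
Proof.
move=> Sp0; have [p0_ge0 p0_sum] := hSprob Sp0; split=> [j|].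
  by rewrite mxE sumr_ge0// => i _; rewrite mulr_ge0// (restriction_ge0 ha).
have sumE k (v : 'cV[R]_k) : \sum_i v i 0 = ((const_mx 1 : 'rV[R]_k) *m v) 0 0.
  by rewrite mxE; apply: eq_bigr => i _; rewrite mxE mul1r.
by rewrite sumE ones_restriction_reach -?sumE// init_reach.
Qed.

Lemma reduced_output_stochastic : column_stochastic (C *m J).
Proof.
split=> [y j|j].
  by rewrite mxE sumr_ge0// => i _; rewrite mulr_ge0 ?hPC.2.1// (injection_ge0 ha).
have /rowP/(_ j) := ones_injection ha hp; rewrite [RHS]mxE => <-; rewrite mxE.
under eq_bigr do rewrite mxE.
rewrite exchange_big; apply: eq_bigr => i _ /=.
by rewrite -mulr_suml hPC.2.2 mxE.
Qed.

(* Otherwise the atom [tnth a j] annihilates the nonnegative generators of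
   [reach], hence [X], hence all of [A], in particular itself. *)
Lemma reach_charges X j : A = distorted_alg p X -> (X <= reach)%VS ->
  exists x, [/\ x \in reach, forall i, 0 <= x i 0 & 0 < (Q *m x) j 0].
Proof.
move=> AX XR.
have gen_ge0 y0 s p0 i : S p0 -> 0 <= (cond_seq P C y0 s *m p0) i 0.
  move=> /hSprob[p0_ge0 _]; rewrite mxE sumr_ge0// => k _.
  by rewrite mulr_ge0// cond_seq_ge0.
apply: contrapT => none.
pose killed : {vspace 'cV[R]_n} :=
    lker (linfun (mulmx (diag_mx (tnth a j)^T) : 'cV[R]_n -> 'cV[R]_n)).
have killedP (v : 'cV[R]_n) :
    reflect (forall i, tnth a j i 0 * v i 0 = 0) (v \in killed).
  rewrite memv_ker lfunE /=; apply: (iffP eqP) => [/colP h i|h].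
    by have := h i; rewrite mul_diag_mx !mxE.
  by apply/colP => i; rewrite mul_diag_mx !mxE h.
have /subvP reach_killed : (reach <= killed)%VS.
  apply: cond_reach_ind => y0 s p0 Sp0; apply/killedP => i.
  set g := _ *m p0; have g_ge0 k : 0 <= g k 0 by exact: gen_ge0.
  have t_ge0 k : 0 <= tnth a j k 0 * g k 0.
    by rewrite mulr_ge0// (zero_one_basis_ge0 ha).
  have : (Q *m g) j 0 = 0.
    apply: contrapT => /eqP Qg; apply: none; exists g; split=> //.
      exact: mem_cond_reach.
    rewrite lt_def Qg mxE sumr_ge0// => k _.
    by rewrite restrictionE.
  rewrite mxE => /eqP; rewrite psumr_eq0 => [/allP h|k _]; last first.
    by rewrite restrictionE.
  have /h : i \in index_enum 'I_n by rewrite mem_index_enum.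
  by rewrite restrictionE => /eqP.
have : tnth a j \in killed.
  apply: subvP (zero_one_basis_mem ha j); rewrite AX.
  (* [killed] is an ideal for [wedge], so it is a subalgebra and is unaffected by the distortion by
     [entryinv p]. *)
  have [_ _] := alg_smallest [set wedge (entryinv p) x | x in [set` X]].
  apply=> [u v /killedP uK _|_ [x xX <-]]; apply/killedP => i.
    by rewrite mxE mulrA uK mul0r.
  by rewrite mxE mulrCA (killedP _ (reach_killed _ (subvP XR _ xX))) mulr0.
move=> /killedP aj; have /eqP := zero_one_basis_neq0 ha j; apply.
apply/colP => i; rewrite mxE.
by have := aj i; rewrite (zero_one_basis_mul ha) eqxx mul1r.
Qed.

(* The column sums of [Q *m P *m J] are at most 1. Averaged with the weights
   [Q *m x], for a nonnegative reachable [x], their defects vanish since total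
   mass is preserved along [reach]. *)
Lemma reduced_transition_stochastic X :
  A = distorted_alg p X -> (X <= reach)%VS -> column_stochastic (Q *m P *m J).
Proof.
move=> AX XR.
have PJ_ge0 i j : 0 <= (P *m J) i j.
  rewrite mxE sumr_ge0// => k _.
  by rewrite mulr_ge0 ?hPC.1.1 ?(injection_ge0 ha).
have T_ge0 i j : 0 <= (Q *m P *m J) i j.
  by rewrite -mulmxA mxE sumr_ge0// => k _; rewrite mulr_ge0// (restriction_ge0 ha).
split=> // j; pose ones : 'rV[R]_n := const_mx 1.
pose w : 'rV[R]_d := const_mx 1 - const_mx 1 *m (Q *m P *m J).
have w_ge0 k : 0 <= w 0 k.
  (* Since [P] and [J] preserve mass, any defect comes from the indices that [Q] drops. *)
  have -> : w = (ones - (const_mx 1 : 'rV[R]_d) *m Q) *m (P *m J).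
    rewrite mulmxBl mulmxA (ones_transition hPC) (ones_injection ha hp).
    by rewrite /w !mulmxA.
  rewrite mxE sumr_ge0// => i _; rewrite mulr_ge0// !mxE subr_ge0.
  under eq_bigr do rewrite mxE mul1r restrictionE.
  exact: (sum_zero_one_basis_le1 ha).
have [x [xR x_ge0 Qxj]] := reach_charges j AX XR.
(* Both terms of the defect equal the mass of [condexp a p *m x], which is again reachable. *)
have wQx : w *m (Q *m x) = 0.
  have /condexp_unobs := xR; rewrite memv_cap => /andP[ER _].
  have {}ER : condexp a p *m x \in reach.
    by rewrite -(subrK x (_ *m x)) memvD.
  rewrite /w mulmxBl (ones_restriction ha hp).
  rewrite -[const_mx 1 *m _ *m (Q *m x)]mulmxA.
  rewrite (_ : _ *m (_ *m x) = Q *m (P *m (condexp a p *m x))); last first.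
    by rewrite condexp_factor !mulmxA.
  rewrite (ones_restriction_reach (transition_reach hPC ER)).
  by rewrite [_ *m (P *m _)]mulmxA (ones_transition hPC) subrr.
suff : w 0 j = 0.
  rewrite mxE [X in X + _]mxE mxE mxE => /eqP; rewrite subr_eq0 => /eqP ->.
  by apply: eq_bigr => i _; rewrite [const_mx _ _ _]mxE mul1r.
have /matrixP/(_ 0 0) := wQx; rewrite mxE [RHS]mxE => /eqP.
have Qx_ge0 k : 0 <= (Q *m x) k 0.
  by rewrite mxE sumr_ge0// => i _; rewrite mulr_ge0// (restriction_ge0 ha).
rewrite psumr_eq0 => [/allP h|k _]; last exact: mulr_ge0.
have /h : j \in index_enum 'I_d by rewrite mem_index_enum.
by rewrite mulf_eq0 (gt_eqF Qxj) orbF => /eqP.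
Qed.

End Reduction.

Theorem theorem2 (R : realType) (n m : nat)
    (P : 'M[R]_n) (C : 'M[R]_(m, n)) (S : set 'cV[R]_n)
    (hPC : hmm P C)
    (hC01 : forall y i, C y i = 0 \/ C y i = 1)
    (hSfin : finite_set S)
    (hSprob : forall p0, S p0 -> prob_vector p0)
    (E : {vspace 'cV[R]_n})
    (hEdir : directv ((cond_reach P C S :&: cond_nonobs P C) + E))
    (hEsum : ((cond_reach P C S :&: cond_nonobs P C) + E)%VS = cond_reach P C S)
    (p : 'cV[R]_n) (hp : forall i, 0 < p i 0)
    (d0 : nat) (a0 : d0.-tuple 'cV[R]_n)
    (ha0 : zero_one_basis (distorted_alg p E) a0)
    (A : {vspace 'cV[R]_n}) (hA : A = reduction_alg P C S E p a0)
    (d : nat) (hd : d = \dim A) (a : d.-tuple 'cV[R]_n)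
    (ha : zero_one_basis A a)
    (J : 'M[R]_(n, d)) (hJ : J = injection a p)
    (Q : 'M[R]_(d, n)) (hQ : Q = restriction a) :
  (d <= n)%N /\
  (hmm (Q *m P *m J) (C *m J) /\
   forall p0, S p0 -> prob_vector (Q *m p0)) /\
  (forall (k : nat) (y : k.+1.-tuple 'I_m) (p0 : 'cV[R]_n), S p0 ->
     out_prob P C p0 y = out_prob (Q *m P *m J) (C *m J) (Q *m p0) y).

Proof.
set reach := cond_reach P C S; set unobs := (reach :&: cond_nonobs P C)%VS.
have ER : (E <= reach)%VS by rewrite /reach -hEsum addvSr.
(* [X] is the space that generates [A]: [E] if the stability test succeeds, [reach] otherwise. *)
have [X [AX XR fixX]] : exists X : {vspace 'cV[R]_n},
    [/\ A = distorted_alg p X, (X <= reach)%VS &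
      forall x, x \in reach -> condexp a p *m x - x \in unobs].
  move: hA; rewrite /reduction_alg; case: asboolP => [stable|_] AE.
    (* In [x = u + e] the expectation fixes [e], and the test keeps the image of [u] in [unobs]. *)
    exists E; split=> // x; rewrite {1}/reach -hEsum => /memv_addP[u uU [e eE ->]].
    rewrite AE in ha.
    rewrite mulmxDr (condexp_distorted_id hp ha eE) opprD addrACA subrr addr0.
    by rewrite memvB// (condexp_basis_irrelevant ha ha0 hp) stable.
  exists reach; split=> // x xR; rewrite AE in ha.
  by rewrite (condexp_distorted_id hp ha xR) subrr mem0v.
subst J Q; split; last split; last 1 first.
- by move=> k y p0; exact: (reduced_out_prob hPC hC01 ha hp fixX).
- rewrite hd (leq_trans (dimvS (subvf A)))// dimvf.
  by rewrite /dim /= muln1.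
split; last by move=> p0; exact: (reduced_init hPC hSprob ha hp fixX).
split; last exact: (reduced_output_stochastic hPC ha hp).
exact: (reduced_transition_stochastic hPC hSprob ha hp fixX AX XR).
Qed.
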